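(* Let $(P^n_t)_{n\in\mathbb{N},t\ge0}$ be a sequence of strongly continuous semigroups on a Banach space $Z$ with generators $(A^n)_{n\in\mathbb{N}}$ such that there are uniform (in $n$) growth bounds $M\ge1$ and $\omega\in\mathbb{R}$ with $\|P^n_t\|_{L(Z)}\le M\exp(\omega t)$ for $t\ge0$. Let furthermore $D\subset\bigcap_n\operatorname{dom}(A^n)$ be a dense subspace with the following three properties: (i) $D$ is an invariant subspace for all $P^n$, i.e. for all $f\in D$ we have $P^n_tf\in D$ for all $n$ and all $t\ge0$. (ii) There is a norm $\|\cdot\|_D$ on $D$ such that there are uniform growth bounds with respect to $\|\cdot\|_D$, i.e. there are $M_D\ge1$ and $\omega_D\in\mathbb{R}$ with $\|P^n_tf\|_D\le M_D\exp(\omega_Dt)\|f\|_D$ for all $f\in D$, $t\ge0$ and all $n$. (iii) The sequence $A^nf$ converges as $n\to\infty$ for each $f\in D$ in the following sense: there exists a sequence of numbers $a_{nm}\to0$ as $n,m\to\infty$ such that $\|A^nf-A^mf\|\le a_{nm}\|f\|_D$ holds for every $f\in D$ and for all $n,m$. Then there exists a strongly continuous semigroup $(P^\infty_t)_{t\ge0}$ on $Z$ with the same growth bound such that $\lim_{n\to\infty}P^n_tf=P^\infty_tf$ for all $f\in Z$, uniformly on compacts in time and on bounded sets in $D$. Furthermore, on $D$ the convergence is of order $O(a_{nm})$, i.e. for every $T>0$ there is a constant $C_T$ with $\|P^n_tf-P^m_tf\|\le C_Ta_{nm}\|f\|_D$ for all $f\in D$, $t\in[0,T]$ and all $n,m$.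 If in addition $Z=\mathcal{B}^\rho(X)$ for a weighted space $(X,\rho)$ and for each $n\in\mathbb{N}$ $(P^n_t)_{t\ge0}$ is a generalized Feller semigroup, then this property transfers also to the limiting semigroup.
   Context: A weighted space is a completely regular Hausdorff space $X$ with an admissible weight function $\rho:X\to(0,\infty)$, i.e. $K_R=\{\rho\le R\}$ is compact for all $R>0$. $\mathrm{B}^\rho(X)$ is the Banach space of functions $f:X\to\mathbb{R}$ with $\|f\|_\rho=\sup_x\rho(x)^{-1}|f(x)|<\infty$, and $\mathcal{B}^\rho(X)$ is the closure of $C_b(X)$ in $\mathrm{B}^\rho(X)$. A generalized Feller semigroup on $\mathcal{B}^\rho(X)$ is a family of bounded linear operators $(P_t)_{t\ge0}$ on $\mathcal{B}^\rho(X)$ with $P_0=I$, $P_{t+s}=P_tP_s$, $\lim_{t\to0}P_tf(x)=f(x)$ for all $f\in\mathcal{B}^\rho(X)$, $x\in X$, $\|P_t\|_{L(\mathcal{B}^\rho(X))}\le C$ for $t\in[0,\varepsilon]$ for some $C$ and $\varepsilon>0$, and $P_tf\ge0$ for $f\ge0$. Bounded sets in $D$ are meant with respect to $\|\cdot\|_D$. *)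

(* Defs.v *)
From HB Require Import structures.
From mathcomp Require Import all_boot all_order all_algebra.
From mathcomp Require Import all_classical all_reals all_analysis.

Set Implicit Arguments.
Unset Strict Implicit.
Unset Printing Implicit Defensive.

Import Order.TTheory GRing.Theory Num.Theory.
Import numFieldNormedType.Exports.

Local Open Scope classical_set_scope.
Local Open Scope ring_scope.

Section Operators.
Context {R : realType} {V W : normedModType R}.

Definition opnorm (T : V -> W) : \bar R :=
  ereal_sup [set `|T z|%:E | z in [set z : V | `|z| <= 1]].

Definition bounded_operator (T : V -> W) : Prop :=
  linear T /\ (opnorm T < +oo)%E.

End Operators.

(* Semigroups are indexed by all of R; the values at negative times are never
   constrained and never used. *)
Section Semigroups.
Context {R : realType} {Z : normedModType R}.

Record strongly_continuous_semigroup (P : R -> Z -> Z) : Prop := {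
  scsg_bounded : forall t, 0 <= t -> bounded_operator (P t) ;
  scsg_id : forall f, P 0 f = f ;
  scsg_add : forall s t, 0 <= s -> 0 <= t -> forall f, P (t + s) f = P t (P s f) ;
  scsg_cvg : forall f, P t f @[t --> 0^'+] --> f }.

Definition generator_quotient (P : R -> Z -> Z) (f : Z) (h : R) : Z :=
  h^-1 *: (P h f - f).

Definition generator_dom (P : R -> Z -> Z) : set Z :=
  [set f | cvg (generator_quotient P f h @[h --> 0^'+])].

Definition generator (P : R -> Z -> Z) (f : Z) : Z :=
  lim (generator_quotient P f h @[h --> 0^'+]).

(* N is only meant as a function on D; its values outside D are ignored. *)
Record norm_on (D : set Z) (N : Z -> R) : Prop := {
  norm_on_ge0 : forall f, D f -> 0 <= N f ;
  norm_on_eq0 : forall f, D f -> N f = 0 -> f = 0 ;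
  norm_onZ : forall (c : R) f, D f -> N (c *: f) = `|c| * N f ;
  norm_onD : forall f g, D f -> D g -> N (f + g) <= N f + N g }.

End Semigroups.

Record weightedSpace (R : realType) := WeightedSpace {
  wspace :> topologicalType ;
  weight : wspace -> R ;
  wspace_hausdorff : hausdorff_space wspace ;
  wspace_completely_regular : completely_regular_space wspace ;
  weight_gt0 : forall x, 0 < weight x ;
  weight_compact : forall r, 0 < r -> compact [set x | weight x <= r] }.

Section Brho.
Context {R : realType} (X : weightedSpace R).
Implicit Types f g : X -> R.

Definition weighted_values f : set R :=
  range (fun x : X => (weight x)^-1 * `|f x|).

Definition weighted_bounded : {pred X -> R} :=
  mem [set f | has_ubound (weighted_values f)].

(* For empty X the set of weighted values is empty and its sup is 0. *)
Definition weighted_norm f : R := sup (weighted_values f).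

Lemma weighted_boundedP f :
  reflect (exists C, forall x, `|f x| <= weight x * C) (f \in weighted_bounded).
Proof.
apply: (iffP idP); rewrite inE/=.
- case=> C fC; exists C => x; rewrite -ler_pdivrMl ?weight_gt0//.
  by apply: fC; exists x.
- case=> C fC; exists C => _ [x _ <-].
  by rewrite ler_pdivrMl ?weight_gt0.
Qed.

Lemma weighted_norm_le f (C : R) : 0 <= C ->
  (forall x, `|f x| <= weight x * C) -> weighted_norm f <= C.
Proof.
move=> C0 fC; rewrite /weighted_norm.
have [->|/set0P ne] := eqVneq (weighted_values f) set0; first by rewrite sup0.
apply: ge_sup => // _ [x _ <-].
by rewrite ler_pdivrMl ?weight_gt0.
Qed.

Lemma weighted_norm_ge f x : f \in weighted_bounded ->
  `|f x| <= weight x * weighted_norm f.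
Proof.
rewrite inE/= => fb; rewrite -ler_pdivrMl ?weight_gt0//.
by apply: ub_le_sup => //; exists x.
Qed.

Lemma weighted_norm_ge0 f : 0 <= weighted_norm f.
Proof.
rewrite /weighted_norm; have [fS|/sup_out ->//] := pselect (has_sup (weighted_values f)).
have [_ [x _ _]] := fS.1.
apply: (@le_trans _ _ ((weight x)^-1 * `|f x|)).
  by rewrite mulr_ge0 ?invr_ge0 ?(ltW (weight_gt0 _)).
by apply: ub_le_sup; [exact: fS.2|exists x].
Qed.

Lemma weighted_bounded_submod_closed : submod_closed weighted_bounded.
Proof.
split.
  by apply/weighted_boundedP; exists 0 => x; rewrite mulr0 normr0.
move=> a f g /weighted_boundedP[C fC] /weighted_boundedP[D gD].
apply/weighted_boundedP; exists (`|a| * C + D) => x.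
rewrite mulrDr (le_trans (ler_normD _ _))// lerD//.
by rewrite normrM mulrCA ler_wpM2l.
Qed.

HB.instance Definition _ := GRing.isSubmodClosed.Build _ _ weighted_bounded
  weighted_bounded_submod_closed.

Record Brho := MkBrho {
  Brho_fun :> X -> R ;
  Brho_funP : Brho_fun \in weighted_bounded }.

HB.instance Definition _ := [isSub for Brho_fun].
HB.instance Definition _ := [Choice of Brho by <:].
HB.instance Definition _ := [SubChoice_isSubLmodule of Brho by <:].

Let nm (u : Brho) : R := weighted_norm u.

Let nm_ge (u : Brho) x : `|u x| <= weight x * nm u.
Proof. exact/weighted_norm_ge/Brho_funP. Qed.

Let nmD (u v : Brho) : nm (u + v) <= nm u + nm v.
Proof.
apply: weighted_norm_le => [|x]; first by rewrite addr_ge0 ?weighted_norm_ge0.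
by rewrite mulrDr (le_trans (ler_normD _ _))// lerD.
Qed.

Let nmZ_le (a : R) (u : Brho) : nm (a *: u) <= `|a| * nm u.
Proof.
apply: weighted_norm_le => [|x]; first by rewrite mulr_ge0 ?weighted_norm_ge0.
by rewrite [leLHS]normrM mulrCA ler_wpM2l.
Qed.

Let nmZ (a : R) (u : Brho) : nm (a *: u) = `|a| * nm u.
Proof.
apply/eqP; rewrite eq_le nmZ_le/=.
have [->|a0] := eqVneq a 0; first by rewrite normr0 mul0r weighted_norm_ge0.
have := nmZ_le a^-1 (a *: u).
by rewrite scalerA mulVf// scale1r normfV ler_pdivlMl ?normr_gt0.
Qed.

Let nm_eq0 (u : Brho) : nm u = 0 -> u = 0.
Proof.
move=> u0; apply/val_inj/funext => x /=.
by apply/eqP; rewrite -normr_le0 (le_trans (nm_ge _ _))// u0 mulr0.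
Qed.

HB.instance Definition _ := Lmodule_isNormed.Build R Brho nmD nmZ nm_eq0.

Lemma Brho_normE (u : Brho) : `|u| = weighted_norm u. Proof. by []. Qed.

Lemma Brho_complete (F : set_system Brho) :
  ProperFilter F -> cauchy F -> cvg F.
Proof.
move=> FF /cauchy_ballP Fc.
have Fe e : 0 < e -> \forall u & v \near F, `|u - v| < e.
  by move=> e0; have := Fc _ e0.
have cvx x : cvg ((u : Brho) x @[u --> F]).
  apply: R_complete; apply/cauchy_ballP => e e0.
  have := Fe (e / weight x) (divr_gt0 e0 (weight_gt0 x)).
  move=> [[A B]/= [FA FB] AB].
  exists ((fun u : Brho => u x) @` A, (fun u : Brho => u x) @` B) => /=.
    by split; [apply: filterS FA|apply: filterS FB] => u ? /=; exists u.
  move=> [_ _] /= [[u Au <-] [v Bv <-]].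
  have := AB (u, v) (conj Au Bv) => /=.
  rewrite ltr_pdivlMr ?weight_gt0// mulrC; apply: le_lt_trans.
  exact: (nm_ge (u - v)).
pose g x := lim ((u : Brho) x @[u --> F]).
have Fg e : 0 < e ->
    \forall u \near F, forall x, `|(u : Brho) x - g x| <= weight x * e.
  move=> e0; have [[A B]/= [FA FB] AB] := Fe _ e0.
  apply: filterS FA => u Au x.
  have cu : `|u x - (v : Brho) x| @[v --> F] --> `|u x - g x|.
    by apply: cvg_norm; apply: cvgB; [exact: cvg_cst|exact: cvx].
  rewrite -(cvg_lim _ cu)//; apply: limr_le; first by apply/cvg_ex; eexists; exact: cu.
  apply: filterS FB => v Bv; apply: (le_trans (nm_ge (u - v) x)).
  by rewrite ler_pM2l ?weight_gt0// ltW//; exact: (AB (u, v)).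
have gb : g \in weighted_bounded.
  have [u ug] := filter_ex (Fg _ ltr01).
  apply/weighted_boundedP; exists (nm u + 1) => x.
  rewrite mulrDr -(subKr (u x) (g x)) (le_trans (ler_normB _ _))//.
  by rewrite lerD// nm_ge.
apply/cvg_ex; exists (MkBrho gb); apply/cvgrPdist_le => e e0.
apply: filterS (Fg _ e0) => u ug; rewrite distrC.
by apply: weighted_norm_le => //; exact: ltW.
Qed.

HB.instance Definition _ := Uniform_isComplete.Build Brho Brho_complete.

(* Belonging to Brho is no restriction on a bounded continuous function, see
   bounded_fun_weighted_bounded below. *)
Definition Cb : set Brho :=
  [set u | continuous (u : X -> R) /\ bounded_fun (u : X -> R)].

Definition calBrho_pred : {pred Brho} := mem (closure Cb).

Lemma bounded_fun_weighted_bounded f :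
  bounded_fun f -> f \in weighted_bounded.
Proof.
move=> [M [_ fM]].
have {}fM x : `|f x| <= `|M| + 1.
  by apply: (fM _ _ x I); rewrite ltr_pwDr// ler_norm.
suff [d d0 dw] : exists2 d : R, 0 < d & forall x : X, d <= weight x.
  apply/weighted_boundedP; exists (d^-1 * (`|M| + 1)) => x.
  rewrite mulrA (le_trans (fM x))// ler_peMl ?addr_ge0//.
  by rewrite ler_pdivlMr// mul1r.
apply: contrapT => nd.
pose K (r : R) : set X := [set x | weight x <= r].
have K0 r : 0 < r -> K r !=set0.
  move=> r0; apply: contrapT => nK; apply: nd; exists r => // x.
  by rewrite leNgt; apply/negP => xr; apply: nK; exists x; exact: ltW.
pose F := filter_from [set r : R | 0 < r] K.
have FF : ProperFilter F.
  apply: filter_from_proper => //; apply: filter_from_filter.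
    by exists 1; exact: ltr01.
  move=> r s r0 s0; exists (Num.min r s) => [|x].
    by rewrite /= lt_min r0.
  by rewrite /K/= le_min => /andP[].
have [p [_ pF]] := @weight_compact R X 1 ltr01 F FF (ex_intro2 _ _ 1 ltr01 (@subset_refl _ _)).
have p2 : 0 < weight p / 2 by rewrite divr_gt0// weight_gt0.
have : closure (K (weight p / 2)) p.
  by move=> B pB; apply: pF => //; exists (weight p / 2).
rewrite -(closure_id _).1; last first.
  by apply: compact_closed; [exact: wspace_hausdorff|exact: weight_compact].
by rewrite /K/= leNgt ltr_pdivrMr// ltr_pMr ?weight_gt0// ltr1n.
Qed.

Lemma calBrho_predP (u : Brho) : reflect
  (forall e : R, 0 < e -> exists2 v, Cb v & `|u - v| < e) (u \in calBrho_pred).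
Proof.
apply: (iffP idP); rewrite inE/=.
- move=> clu e e0.
  have [v [Cv uv]] := clu _ (nbhsx_ballx u e e0).
  by exists v.
- move=> H B /nbhs_ballP[e /= e0 eB].
  by have [v Cv uv] := H _ e0; exists v; split => //; exact: eB.
Qed.

Lemma Cb_lin (a : R) (u v : Brho) : Cb u -> Cb v -> Cb (a *: u + v).
Proof.
move=> [uc [M [_ uM]]] [vc [N [_ vN]]]; split.
  move=> x; apply: cvgD; last exact: vc.
  by apply: cvgM; [exact: cvg_cst|exact: uc].
exists (`|a| * (M + 1) + (N + 1)); split=> [|K aK x _]; first exact: num_real.
have uM1 : `|u x| <= M + 1 by exact: uM (ltr_pwDr ltr01 (lexx M)) x I.
have vN1 : `|v x| <= N + 1 by exact: vN (ltr_pwDr ltr01 (lexx N)) x I.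
apply: le_trans (ltW aK).
by rewrite [leLHS]/= (le_trans (ler_normD _ _))// lerD// normrM ler_wpM2l.
Qed.

Lemma calBrho_submod_closed : submod_closed calBrho_pred.
Proof.
split.
  apply/calBrho_predP => e e0; exists 0; last by rewrite subrr normr0.
  split; first by move=> x; exact: cvg_cst.
  exists 0; split=> [|K K0 x _]; first exact: num_real.
  by rewrite /= normr0 ltW.
move=> a u v /calBrho_predP uP /calBrho_predP vP.
apply/calBrho_predP => e e0.
have a0 : 0 < `|a| + 1 by rewrite ltr_wpDl.
have [u' Cu uu'] := uP (e / 2 / (`|a| + 1)) (divr_gt0 (divr_gt0 e0 (ltr0Sn _ 1)) a0).
have [v' Cv vv'] := vP (e / 2) (divr_gt0 e0 (ltr0Sn _ 1)).
exists (a *: u' + v'); first exact: Cb_lin.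
rewrite opprD addrACA -scalerBr (le_lt_trans (ler_normD _ _))//.
rewrite (splitr e) ler_ltD// normrZ.
rewrite ltr_pdivlMr// in uu'; apply: le_trans (ltW uu').
by rewrite mulrC ler_wpM2l// lerDl.
Qed.

HB.instance Definition _ := GRing.isSubmodClosed.Build _ _ calBrho_pred
  calBrho_submod_closed.

Record calBrho := MkCalBrho {
  calBrho_val :> Brho ;
  calBrho_valP : calBrho_val \in calBrho_pred }.

HB.instance Definition _ := [isSub for calBrho_val].
HB.instance Definition _ := [Choice of calBrho by <:].
HB.instance Definition _ := [SubChoice_isSubLmodule of calBrho by <:].

Let cnm (u : calBrho) : R := `|calBrho_val u|.

Let cnmD (u v : calBrho) : cnm (u + v) <= cnm u + cnm v.
Proof. exact: ler_normD. Qed.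

Let cnmZ (a : R) (u : calBrho) : cnm (a *: u) = `|a| * cnm u.
Proof. exact: normrZ. Qed.

Let cnm_eq0 (u : calBrho) : cnm u = 0 -> u = 0.
Proof. by move=> /normr0_eq0 u0; exact: val_inj. Qed.

HB.instance Definition _ := Lmodule_isNormed.Build R calBrho cnmD cnmZ cnm_eq0.

Lemma calBrho_normE (u : calBrho) : `|u| = weighted_norm u. Proof. by []. Qed.

Lemma calBrho_complete (F : set_system calBrho) :
  ProperFilter F -> cauchy F -> cvg F.
Proof.
move=> FF /cauchy_ballP Fc.
have : cvg (calBrho_val @ F).
  apply: cauchy_cvg; apply/cauchy_ballP => e e0.
  have [[A B]/= [FA FB] AB] := Fc _ e0.
  exists (calBrho_val @` A, calBrho_val @` B) => /=.
    by split; [apply: filterS FA|apply: filterS FB] => u ? /=; exists u.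
  by move=> [_ _] /= [[u Au <-] [v Bv <-]]; exact: (AB (u, v)).
move=> /cvg_ex[/= g Fg].
have gB : g \in calBrho_pred.
  rewrite inE/=; apply: (@closed_cvg _ _ F FF calBrho_val (closure Cb)) => //.
    exact: closed_closure.
  by apply: nearW => u; have := calBrho_valP u; rewrite inE.
apply/cvg_ex; exists (MkCalBrho gB); apply/cvgrPdist_le => e e0.
by move/cvgrPdist_le : Fg => /(_ _ e0).
Qed.

HB.instance Definition _ := Uniform_isComplete.Build calBrho calBrho_complete.

Record generalized_feller_semigroup (P : R -> calBrho -> calBrho) : Prop := {
  gfsg_bounded : forall t, 0 <= t -> bounded_operator (P t) ;
  gfsg_id : forall f : calBrho, P 0 f = f ;
  gfsg_add : forall s t, 0 <= s -> 0 <= t -> forall f : calBrho, P (t + s) f = P t (P s f) ;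
  gfsg_cvg : forall (f : calBrho) (x : X), P t f x @[t --> 0^'+] --> f x ;
  gfsg_locally_bounded : exists (C : R) (e : R), 0 < e /\
    (forall t, 0 <= t <= e -> (opnorm (P t) <= C%:E)%E) ;
  gfsg_positive : forall t, 0 <= t -> forall f : calBrho,
    (forall x : X, 0 <= f x) -> forall x : X, 0 <= P t f x }.

End Brho.

(* Main.v *)
Require Import Defs.
From mathcomp Require Import all_boot all_order all_algebra.
From mathcomp Require Import all_classical all_reals all_analysis.
From mathcomp Require Import lra.
Import Order.TTheory GRing.Theory Num.Theory.
Import numFieldNormedType.Exports.
Local Open Scope classical_set_scope.
Local Open Scope ring_scope.

(** The theorem is a Trotter-Kato argument.  For f in D and a fixed time T, the
    curve u(s) = P^m_{T-s} P^n_s f joins P^m_T f to P^n_T f, and formally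
    u'(s) = P^m_{T-s} (A^n - A^m) P^n_s f.  Since P^n_s f stays in D, with
    D-norm at most M_D exp(omega_D s) |f|_D, the derivative is bounded by a
    constant times a_nm |f|_D; this gives the O(a_nm) estimate
    [semigroup_rate].

    The orbit of f may be discontinuous for the D-norm, and with it
    s |-> (A^n - A^m) P^n_s f.  Hence, instead of integrating u', the proof
    bounds the right difference quotients of u: one has
      u(s+h) - u(s) = P^m_{T-s-h} (P^n_h - P^m_h) P^n_s f,
    and (P^n_h - P^m_h) g / h tends to (A^n - A^m) g at each g in both domains.
    The mean value inequality [right_mean_value_le] for left-continuous curves
    then concludes; this is [semigroup_diff_le].

    As a_nm tends to 0, the sequence P^n_t f is Cauchy uniformly in t in
    [0, T], first for f in a set bounded for the D-norm
    ([semigroup_cauchy_dom]), then, by density of D and the uniform growth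
    bound, for each f in Z ([semigroup_cauchy]).  The limit is a semigroup
    with the same growth bound, and it is strongly continuous because the
    convergence is uniform for t in [0, 1] ([limit_semigroup_scsg]).

    On calBrho X evaluation at a point is continuous, so positivity passes to
    the limit, and pointwise convergence at time 0 follows from strong
    continuity ([generalized_feller_limit]). *)

(** * Operator norm and linearity *)

Section OperatorNorm.
Context {R : realType} {V W : normedModType R}.
Implicit Types T : V -> W.

Lemma linear_subr {T} : linear T -> forall u v, T (u - v) = T u - T v.
Proof.
by move=> lT u v; rewrite addrC -[- v]scaleN1r lT scaleN1r addrC.
Qed.

Lemma linear_scale {T} : linear T -> forall (c : R) u, T (c *: u) = c *: T u.
Proof.
move=> lT c u; have T0 : T 0 = 0 by rewrite -[0 in LHS](subrr 0) linear_subr// subrr.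
by rewrite -[c *: u]addr0 lT T0 addr0.
Qed.

Lemma opnorm_bound {T} {c : R} : linear T -> (opnorm T <= c%:E)%E ->
  forall z, `|T z| <= c * `|z|.
Proof.
move=> lT Tc z; have [->|z0] := eqVneq z 0.
  by rewrite -[0 in leLHS](subrr 0) linear_subr// subrr !normr0 mulr0.
have nz0 : 0 < `|z| by rewrite normr_gt0.
rewrite -ler_pdivrMr// mulrC -[`|z|^-1]ger0_norm ?invr_ge0//.
rewrite -normrZ -linear_scale// -lee_fin; apply: le_trans Tc.
apply: ereal_sup_ubound; exists (`|z|^-1 *: z) => //=.
by rewrite normrZ ger0_norm ?invr_ge0// mulVf ?gt_eqF.
Qed.

Lemma opnorm_le {T} {c : R} : 0 <= c -> (forall z, `|T z| <= c * `|z|) ->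
  (opnorm T <= c%:E)%E.
Proof.
move=> c0 Tc; apply: ge_ereal_sup => _ [z /= z1 <-].
by rewrite lee_fin (le_trans (Tc z))// ler_piMr.
Qed.

Lemma bounded_operator_le {T} {c : R} : 0 <= c -> linear T ->
  (forall z, `|T z| <= c * `|z|) -> bounded_operator T.
Proof.
by move=> c0 lT Tc; split=> //; apply: le_lt_trans (ltry c); exact: opnorm_le.
Qed.

End OperatorNorm.

(** * Right mean value inequality *)

(** The set of s such that |u r - u 0| <= (K + e) r on [0, s] contains its
    supremum c by left continuity, and the right-hand bound at c would extend it
    beyond c if c were smaller than T.  The slack e is what makes the bound
    hold on a whole right neighbourhood of c; it tends to 0 at the end. *)
Lemma right_mean_value_le {R : realType} {V : normedModType R} {u : R -> V}
    {T K : R} :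
  0 <= T -> 0 <= K ->
  (forall s, 0 < s <= T -> u r @[r --> s^'-] --> u s) ->
  (forall s e, 0 <= s < T -> 0 < e ->
    \forall h \near 0^'+, `|u (s + h) - u s| <= (K + e) * h) ->
  `|u T - u 0| <= K * T.
Proof.
move=> T0 K0 ul ur.
suff H e : 0 < e -> `|u T - u 0| <= (K + e) * T.
  apply/ler_addgt0Pr => e e0.
  have T1 : 0 < T + 1 by rewrite ltr_wpDl.
  apply: le_trans (H _ (divr_gt0 e0 T1)) _.
  rewrite mulrDl lerD2l mulrAC ler_pdivrMr// ler_pM2l// lerDl; exact: ler01.
move=> e0; have L0 : 0 <= K + e by rewrite addr_ge0// ltW.
set L := K + e in L0 *.
pose S := [set s | 0 <= s <= T /\ forall r, 0 <= r <= s -> `|u r - u 0| <= L * r].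
have S0 : S 0.
  split=> [|r]; first by rewrite lexx.
  by rewrite -eq_le => /eqP <-; rewrite subrr normr0 mulr0.
have Sub : has_ubound S by exists T => s [/andP[]].
set c := sup S.
have c0 : 0 <= c by exact: ub_le_sup.
have cT : c <= T by apply: ge_sup => [|s [/andP[]]//]; exists 0.
have below r : 0 <= r < c -> `|u r - u 0| <= L * r.
  move=> /andP[r0 rc]; have [s [_ sS] rs] := sup_gt (ex_intro _ _ S0) rc.
  by apply: sS; rewrite r0 ltW.
have atc : `|u c - u 0| <= L * c.
  move: c0; rewrite le_eqVlt => /predU1P[<-|c0]; first by rewrite subrr normr0 mulr0.
  apply/ler_addgt0Pr => d d0.
  have cc : 0 < c <= T by rewrite c0.
  have /filter_ex[r [[rc r0] ucr]] : \forall r \near c^'-, (r < c /\ 0 < r) /\ `|u c - u r| <= d.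
    apply: filterI; last by move/cvgrPdist_le: (ul _ cc); exact.
    by apply: filterI; [exact: nbhs_left_lt|exact: nbhs_left_gt].
  rewrite -(subrKA (u r)) (le_trans (ler_normD _ _))// addrC lerD//.
  rewrite (le_trans (below r _)) ?(ltW r0)//.
  by rewrite ler_wpM2l// ltW.
have upto r : 0 <= r <= c -> `|u r - u 0| <= L * r.
  move=> /andP[r0]; rewrite le_eqVlt => /predU1P[->//|rc].
  by apply: below; rewrite r0.
have [<-//|cNT] := eqVneq c T.
have ccT : 0 <= c < T by rewrite c0 lt_neqAle cNT.
have [d /= d0 dP] := ur c e ccT e0.
exfalso.
pose m := Num.min (d / 2) (T - c).
have m0 : 0 < m by rewrite lt_min divr_gt0//= subr_gt0; case/andP: ccT.
have : S (c + m).
  split.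
    rewrite addr_ge0 ?(ltW m0)//= -lerBrDl /m ge_min lexx orbT//.
  move=> r /andP[r0 rcm]; have [rc|cr] := leP r c; first by apply: upto; rewrite r0.
  have rc0 : 0 < r - c by rewrite subr_gt0.
  have rcd : r - c < d.
    have : r - c <= d / 2.
      by rewrite lerBlDl (le_trans rcm)// lerD2l /m ge_min lexx.
    by move=> /le_lt_trans; apply; rewrite ltr_pdivrMr// ltr_pMr// ltr1n.
  have := dP (r - c); rewrite /ball_/= sub0r normrN gtr0_norm// => /(_ rcd rc0).
  rewrite subrKC -/L => urc.
  rewrite -(subrKA (u c)) (le_trans (ler_normD _ _))//.
  by rewrite (le_trans (lerD urc atc))// -mulrDr subrK.
move=> /(ub_le_sup Sub); rewrite -/c gerDl leNgt m0//.
Qed.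

(** * Comparison of two semigroups *)

Section SemigroupComparison.
Context {R : realType} {Z : normedModType R}.
Implicit Types P Q : R -> Z -> Z.

Lemma generator_quotient_cvg {P f} : generator_dom P f ->
  generator_quotient P f h @[h --> 0^'+] --> generator P f.
Proof. by []. Qed.

Lemma semigroup_near0 {P} f {e : R} : strongly_continuous_semigroup P ->
  0 < e -> \forall h \near 0^'+, `|P h f - f| <= e.
Proof.
move=> sP e0; have Pf : P t f @[t --> 0^'+] --> f by exact: (@scsg_cvg _ _ _ sP).
by move/cvgrPdistC_le : Pf; apply.
Qed.

(** Dividing by h, the left-hand side is the difference of the two generator
    quotients, whose limit has norm at most L. *)
Lemma semigroup_diff_near {P Q f} {L e : R} : generator_dom P f ->
  generator_dom Q f -> `|generator P f - generator Q f| <= L -> 0 < e ->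
  \forall h \near 0^'+, `|P h f - Q h f| <= (L + e) * h.
Proof.
move=> dP dQ fL e0.
have fLe : `|generator P f - generator Q f| < L + e.
  by rewrite (le_lt_trans fL)// ltrDl.
have quot_near := cvgr_norm_le _
  (cvgB (generator_quotient_cvg dP) (generator_quotient_cvg dQ)) _ fLe.
near=> h.
have h0 : 0 < h by near: h; exact: nbhs_right_gt.
rewrite -ler_pdivrMr// mulrC -[h^-1]gtr0_norm ?invr_gt0// -normrZ.
have -> : h^-1 *: (P h f - Q h f) =
    generator_quotient P f h - generator_quotient Q f h.
  by rewrite /generator_quotient -scalerBr opprB addrA subrK.
near: h; exact: quot_near.
Unshelve. all: by end_near. Qed.

(** Only the orbit of f under P has to lie in the two domains: the curve
    s |-> Q (T - s) (P s f) is differentiated on the right by splitting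
    Q (T - s) as Q (T - s - h) \o Q h, so that both semigroups act for the short
    time h on the same vector P s f. *)
Lemma semigroup_diff_le {P Q} {T B L : R} {f} :
  strongly_continuous_semigroup P -> strongly_continuous_semigroup Q ->
  0 <= T -> 0 <= B -> 0 <= L ->
  (forall (t : R) z, 0 <= t <= T -> `|P t z| <= B * `|z|) ->
  (forall (t : R) z, 0 <= t <= T -> `|Q t z| <= B * `|z|) ->
  (forall s : R, 0 <= s < T -> generator_dom P (P s f)) ->
  (forall s : R, 0 <= s < T -> generator_dom Q (P s f)) ->
  (forall s : R, 0 <= s < T ->
    `|generator P (P s f) - generator Q (P s f)| <= L) ->
  `|P T f - Q T f| <= B * L * T.
Proof.
move=> sP sQ T0 B0 L0 PB QB dP dQ PQL.
have lP t : 0 <= t -> linear (P t) by move=> /(scsg_bounded sP)[].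
have lQ t : 0 <= t -> linear (Q t) by move=> /(scsg_bounded sQ)[].
pose u s := Q (T - s) (P s f).
have -> : P T f - Q T f = u T - u 0.
  by rewrite /u subrr subr0 (scsg_id sQ) (scsg_id sP).
apply: right_mean_value_le => //; first exact: mulr_ge0.
- move=> s /andP[s0 sT]; apply/cvgrPdist_le => e e0; apply/nbhs_left0P.
  pose B1 := B + B * B + 1.
  have B10 : 0 < B1 by rewrite ltr_wpDl// addr_ge0// mulr_ge0.
  have e1 : 0 < e / B1 by rewrite divr_gt0.
  have Qg := semigroup_near0 (P s f) sQ e1.
  have Pf := semigroup_near0 f sP e1.
  near=> h.
  have h0 : 0 < h by near: h; exact: nbhs_right_gt.
  have hs : h < s by near: h; exact: nbhs_right_lt.
  have sh0 : 0 <= s - h by rewrite subr_ge0 ltW.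
  have Ts0 : 0 <= T - s by rewrite subr_ge0.
  have Tsh0 : 0 <= T - (s - h) by rewrite subr_ge0 (le_trans _ sT)// gerBl ltW.
  (* change the time of Q while P stays at s, then the time of P *)
  have -> : u s - u (s - h) =
      Q (T - s) (P s f - Q h (P s f)) + Q (T - (s - h)) (P (s - h) (P h f - f)).
    rewrite (linear_subr (lQ _ Ts0)) (linear_subr (lP _ sh0)).
    rewrite (linear_subr (lQ _ Tsh0)) -(scsg_add sQ (ltW h0) Ts0).
    rewrite -(scsg_add sP (ltW h0) sh0) subrK.
    have <- : T - (s - h) = T - s + h by rewrite opprB addrA addrAC.
    by rewrite subrKA.
  have H1 : `|P s f - Q h (P s f)| <= e / B1.
    by rewrite distrC; near: h; exact: Qg.
  have H2 : `|P h f - f| <= e / B1 by near: h; exact: Pf.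
  apply: (le_trans (ler_normD _ _)).
  apply: (@le_trans _ _ (B * (e / B1) + B * (B * (e / B1)))).
    apply: lerD.
      apply: le_trans (QB _ _ _) _; last by rewrite ler_wpM2l.
      by rewrite Ts0 gerBl ltW.
    apply: le_trans (QB _ _ _) _.
      by rewrite Tsh0 gerBl.
    rewrite ler_wpM2l//; apply: le_trans (PB _ _ _) _.
      by rewrite sh0 (le_trans _ sT)// gerBl ltW.
    by rewrite ler_wpM2l.
  by rewrite mulrA -mulrDl mulrCA ler_piMr ?(ltW e0)// ler_pdivrMr// mul1r lerDl.
- move=> s e /andP[s0 sT] e0.
  have sc : 0 <= s < T by rewrite s0.
  have B10 : 0 < B + 1 by rewrite ltr_wpDl.
  have e1 : 0 < e / (B + 1) by rewrite divr_gt0.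
  have near_diff := semigroup_diff_near (dP _ sc) (dQ _ sc) (PQL _ sc) e1.
  near=> h.
  have h0 : 0 < h by near: h; exact: nbhs_right_gt.
  have hT : h < T - s by near: h; apply: nbhs_right_lt; rewrite subr_gt0.
  have Tsh0 : 0 <= T - (s + h) by rewrite opprD addrA subr_ge0 ltW.
  have -> : u (s + h) - u s = Q (T - (s + h)) (P h (P s f) - Q h (P s f)).
    rewrite (linear_subr (lQ _ Tsh0)) -(scsg_add sQ (ltW h0) Tsh0).
    rewrite -(scsg_add sP s0 (ltW h0)) [h + s]addrC.
    by have -> : T - (s + h) + h = T - s by rewrite opprD addrA subrK.
  apply: le_trans (QB _ _ _) _.
    by rewrite Tsh0 gerBl addr_ge0// ltW.
  have : `|P h (P s f) - Q h (P s f)| <= (L + e / (B + 1)) * h.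
    by near: h; exact: near_diff.
  move=> /(ler_wpM2l B0) /le_trans; apply.
  rewrite mulrA ler_wpM2r ?(ltW h0)// mulrDr lerD2l.
  by rewrite mulrCA ler_piMr ?(ltW e0)// ler_pdivrMr// mul1r lerDl.
Unshelve. all: by end_near. Qed.

End SemigroupComparison.

(** * Limits and uniform convergence *)

Lemma cvg_dist_le {R : realType} {V : normedModType R} {x_ : nat -> V} {x y : V}
    {e : R} (N : nat) :
  x_ n @[n --> \oo] --> x -> (forall n, (N <= n)%N -> `|y - x_ n| <= e) ->
  `|y - x| <= e.
Proof.
move=> xx xe; have yx : `|y - x_ n| @[n --> \oo] --> `|y - x|.
  by apply: cvg_norm; apply: cvgB xx; exact: cvg_cst.
rewrite -(cvg_lim _ yx)//; apply: limr_le; first by apply/cvg_ex; eexists; exact: yx.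
by exists N => // n /= Nn; exact: xe.
Qed.

Lemma uniform_cvg_dist {R : realType} {S : choiceType} {V : normedModType R}
    {K : set S} {u : nat -> S -> V} {g : S -> V} :
  (forall e : R, 0 < e -> exists N : nat, forall n x, (N <= n)%N -> K x ->
    `|u n x - g x| <= e) ->
  {uniform K, u n @[n --> \oo] --> g}.
Proof.
move=> ug A /uniform_nbhs[E [entE EA]].
move: entE; rewrite -entourage_ballE => -[e /= e0 eE].
have [N uN] := ug _ (divr_gt0 e0 (ltr0Sn _ 1)).
exists N => // n /= Nn; apply: EA => x Kx; apply: eE => /=.
rewrite -ball_normE /ball_/= distrC; apply: le_lt_trans (uN _ _ Nn Kx) _.
by rewrite ltr_pdivrMr// ltr_pMr// ltr1n.
Qed.

(** * The limit of a locally uniformly Cauchy sequence of semigroups *)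

Section Limit.
Context {R : realType} {Z : completeNormedModType R}.
Context {P : nat -> R -> Z -> Z} {M omega : R}.
Context (M0 : 0 <= M).
Context (sP : forall n, strongly_continuous_semigroup (P n)).
Context (P_le : forall n t z, 0 <= t ->
  `|P n t z| <= M * expR (omega * t) * `|z|).
Context (P_cauchy : forall f (T e : R), 0 < e -> exists N : nat,
  forall n m t, (N <= n)%N -> (N <= m)%N -> 0 <= t <= T ->
  `|P n t f - P m t f| <= e).

Definition limit_semigroup t f := lim (P n t f @[n --> \oo]).

Lemma limit_semigroup_cvg t f : 0 <= t ->
  P n t f @[n --> \oo] --> limit_semigroup t f.
Proof.
move=> t0; apply: cauchy_cvg; apply: cauchy_exP => e e0.
have [N PN] := P_cauchy f t _ (divr_gt0 e0 (ltr0Sn _ 1)).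
exists (P N t f); exists N => // n /= Nn; rewrite -ball_normE /ball_/=.
apply: le_lt_trans (PN N n t _ _ _) _ => //; first by rewrite t0 lexx.
by rewrite ltr_pdivrMr// ltr_pMr// ltr1n.
Qed.

Lemma limit_semigroup_uniform f (T e : R) : 0 < e -> exists N : nat,
  forall n t, (N <= n)%N -> 0 <= t <= T -> `|P n t f - limit_semigroup t f| <= e.
Proof.
move=> e0; have [N PN] := P_cauchy f T e e0; exists N => n t Nn tT.
apply: (cvg_dist_le N (limit_semigroup_cvg t f _)) => [|m Nm].
  by case/andP: tT.
exact: PN.
Qed.

Lemma limit_semigroup_le t z : 0 <= t ->
  `|limit_semigroup t z| <= M * expR (omega * t) * `|z|.
Proof.
move=> t0; rewrite -normrN -sub0r.
by apply: (cvg_dist_le 0 (limit_semigroup_cvg t z t0)) => n _; rewrite sub0r normrN P_le.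
Qed.

Lemma limit_semigroup_scsg : strongly_continuous_semigroup limit_semigroup.
Proof.
have lP n t : 0 <= t -> linear (P n t) by move=> /(scsg_bounded (sP n))[].
split.
- move=> t t0; apply: (@bounded_operator_le _ _ _ _ (M * expR (omega * t))).
  + by rewrite mulr_ge0// expR_ge0.
  + move=> c u v; apply: cvg_lim => //.
    have -> : (fun n => P n t (c *: u + v)) = (fun n => c *: P n t u + P n t v).
      by apply/funext => n; exact: lP.
    by apply: cvgD; [apply: cvgZr|]; exact: limit_semigroup_cvg.
  + by move=> z; exact: limit_semigroup_le.
- move=> f; apply: cvg_lim => //.
  have -> : (fun n => P n 0 f) = (fun=> f).
    by apply/funext => n; rewrite (scsg_id (sP n)).
  exact: cvg_cst.
- move=> s t s0 t0 f; apply: cvg_lim => //.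
  have -> : (fun n => P n (t + s) f) = (fun n => P n t (P n s f)).
    by apply/funext => n; rewrite (scsg_add (sP n)).
  (* the uniform bound on P n t lets P n s f be replaced by its limit g *)
  set g := limit_semigroup s f.
  have -> : (fun n => P n t (P n s f)) = (fun n => P n t (P n s f - g) + P n t g).
    by apply/funext => n; rewrite (linear_subr (lP n _ t0)) subrK.
  rewrite -[X in _ --> X]add0r; apply: cvgD; last exact: limit_semigroup_cvg.
  apply/cvgr0Pnorm_le => e e0.
  have Mt : 0 < M * expR (omega * t) + 1.
    by rewrite ltr_wpDl// mulr_ge0// expR_ge0.
  have /cvgrPdistC_le/(_ _ (divr_gt0 e0 Mt)) := limit_semigroup_cvg s f s0.
  apply: filterS => n Pn; apply: le_trans (P_le _ _ _ t0) _.
  rewrite ler_pdivlMr// in Pn; apply: le_trans Pn.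
  by rewrite mulrC ler_wpM2l// lerDl.
- move=> f; apply/cvgrPdistC_le => e e0.
  have e2 : 0 < e / 2 by rewrite divr_gt0.
  have [N PN] := limit_semigroup_uniform f 1 _ e2.
  have Pf := semigroup_near0 f (sP N) e2.
  near=> h.
  rewrite -(subrKA (P N h f)) (le_trans (ler_normD _ _))// (splitr e) lerD//.
    rewrite distrC PN//; apply/andP; split; near: h; first exact: nbhs_right_ge.
    by apply: nbhs_right_le; exact: ltr01.
  by near: h; exact: Pf.
Unshelve. all: by end_near. Qed.

End Limit.

(** * Stability of generalized Feller semigroups under limits *)

Section Feller.
Context {R : realType} {Z : normedModType R} {X : weightedSpace R}.
Context {J : {linear Z -> calBrho X}} {Jinv : calBrho X -> Z}.
Context (J_norm : forall f, `|J f| = `|f|).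
Context (JK : cancel J Jinv).
Context (JinvK : cancel Jinv J).

Lemma calBrho_eval_le (u v : calBrho X) x :
  `|u x - v x| <= weight x * `|u - v|.
Proof. exact: (weighted_norm_ge x (Brho_funP (calBrho_val (u - v)))). Qed.

Lemma generalized_feller_limit (P : nat -> R -> Z -> Z) (Q : R -> Z -> Z)
    (M omega : R) : 0 <= M ->
  strongly_continuous_semigroup Q ->
  (forall t z, 0 <= t -> `|Q t z| <= M * expR (omega * t) * `|z|) ->
  (forall t f, 0 <= t -> P n t f @[n --> \oo] --> Q t f) ->
  (forall n, generalized_feller_semigroup (fun t g => J (P n t (Jinv g)))) ->
  generalized_feller_semigroup (fun t g => J (Q t (Jinv g))).
Proof.
move=> M0 sQ Q_le PQ fP.
have Jinv_norm g : `|Jinv g| = `|g| by rewrite -J_norm JinvK.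
have QJ_le t g : 0 <= t -> `|J (Q t (Jinv g))| <= M * expR (omega * t) * `|g|.
  by move=> t0; rewrite J_norm -Jinv_norm Q_le.
have Mt t : 0 <= M * expR (omega * t) by rewrite mulr_ge0// expR_ge0.
split.
- move=> t t0; apply: bounded_operator_le (Mt t) _ (fun g => QJ_le t g t0).
  move=> c u v; have -> : Jinv (c *: u + v) = c *: Jinv u + Jinv v.
    by apply: (can_inj JK); rewrite JinvK linearP !JinvK.
  by rewrite (scsg_bounded sQ t0).1 linearP.
- by move=> f; rewrite (scsg_id sQ) JinvK.
- by move=> s t s0 t0 f; rewrite (scsg_add sQ s0 t0) JK.
- move=> f x; apply/cvgrPdistC_le => e e0.
  have ex0 : 0 < e / weight x by rewrite divr_gt0// weight_gt0.
  apply: filterS (semigroup_near0 (Jinv f) sQ ex0) => h Qh.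
  apply: le_trans (calBrho_eval_le _ _ _) _.
  rewrite -[X in _ - X]JinvK -linearB J_norm mulrC -ler_pdivlMr//.
  exact: weight_gt0.
- exists (M * expR (`|omega|)), 1; split => [|t /andP[t0 t1]]; first exact: ltr01.
  apply: opnorm_le => [|g]; first by rewrite mulr_ge0// expR_ge0.
  apply: le_trans (QJ_le t g t0) _; rewrite ler_wpM2r// ler_wpM2l// ler_expR.
  apply: le_trans (ler_norm _) _.
  by rewrite normrM (ger0_norm t0) ler_piMr.
- move=> t t0 f f0 x.
  have cvx : J (P n t (Jinv f)) x @[n --> \oo] --> J (Q t (Jinv f)) x.
    apply/cvgrPdistC_le => e e0.
    have ex0 : 0 < e / weight x by rewrite divr_gt0// weight_gt0.
    have /cvgrPdistC_le/(_ _ ex0) := PQ t (Jinv f) t0.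
    apply: filterS => n Pn; apply: le_trans (calBrho_eval_le _ _ _) _.
    rewrite -linearB J_norm mulrC -ler_pdivlMr//; exact: weight_gt0.
  rewrite -(cvg_lim _ cvx)//; apply: limr_ge.
    by apply/cvg_ex; eexists; exact: cvx.
  by apply: nearW => n; exact: (gfsg_positive (fP n) t0).
Qed.

End Feller.

(** * The Cauchy estimate from convergence of the generators *)

Lemma compact_nonneg_bounded {R : realType} {K : set R} : compact K ->
  K `<=` `[0, +oo[ -> exists2 T : R, 0 < T & K `<=` `[0, T].
Proof.
move=> /compact_bounded[b [_ Kb]] K0; exists (`|b| + 1); first by rewrite ltr_wpDl.
move=> t Kt; have := K0 _ Kt; rewrite /= !in_itv/= andbT => t0; rewrite t0/=.
rewrite -(ger0_norm t0); apply: (Kb (`|b| + 1)) => //.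
by rewrite ltr_pwDr// ler_norm.
Qed.

(** The absolute value covers growth rates of either sign. *)
Lemma expR_growth_le {R : realType} {b t T : R} : 0 <= t <= T ->
  expR (b * t) <= expR (`|b| * T).
Proof.
move=> /andP[t0 tT]; rewrite ler_expR; apply: (@le_trans _ _ (`|b| * t)).
  by rewrite ler_wpM2r// ler_norm.
by rewrite ler_wpM2l.
Qed.

Section GeneratorConvergence.
Context {R : realType} {Z : normedModType R} {P : nat -> R -> Z -> Z}.
Context {M omega : R} {D : set Z} {normD : Z -> R} {M_D omega_D : R}.
Context {a : nat -> nat -> R}.
Context (sP : forall n, strongly_continuous_semigroup (P n)).
Context (M0 : 0 <= M).
Context (P_le : forall n t z, 0 <= t ->
  `|P n t z| <= M * expR (omega * t) * `|z|).
Context (Ddom : forall n, D `<=` generator_dom (P n)).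
Context (Dinv : forall n t f, 0 <= t -> D f -> D (P n t f)).
Context (normD_ge0 : forall f, D f -> 0 <= normD f).
Context (M_D0 : 0 <= M_D).
Context (normD_le : forall n t f, 0 <= t -> D f ->
  normD (P n t f) <= M_D * expR (omega_D * t) * normD f).
Context (generator_le : forall n m f, D f ->
  `|generator (P n) f - generator (P m) f| <= a n m * normD f).

(** The integrand bound M exp(omega (t - s)) M_D exp(omega_D s), estimated
    crudely on [0, T], times the length T of the interval. *)
Definition rate_constant T : R :=
  M * expR (`|omega| * T) * (M_D * expR (`|omega_D| * T)) * T.

Lemma rate_constant_ge0 T : 0 <= T -> 0 <= rate_constant T.
Proof. by move=> T0; rewrite !mulr_ge0// expR_ge0. Qed.

(** The sign of a n m is not prescribed, but the bound on the generators forces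
    0 <= a n m * normD f, so that a negative a n m makes the D-norms of f and
    of its orbit vanish. *)
Lemma generator_orbit_diff_le T n m s f : 0 <= s <= T -> D f ->
  `|generator (P n) (P n s f) - generator (P m) (P n s f)| <=
    M_D * expR (`|omega_D| * T) * (a n m * normD f).
Proof.
move=> sT Df; have s0 : 0 <= s by case/andP: sT.
have Dg := Dinv n _ _ s0 Df.
have g_le : normD (P n s f) <= M_D * expR (`|omega_D| * T) * normD f.
  apply: le_trans (normD_le n _ _ s0 Df) _.
  by rewrite ler_wpM2r ?normD_ge0// ler_wpM2l// expR_growth_le.
apply: le_trans (generator_le n m _ Dg) _; rewrite mulrCA.
have [a0|a0] := leP 0 (a n m); first by rewrite ler_wpM2l.
have f0 : normD f = 0.
  apply/eqP; rewrite eq_le normD_ge0// andbT -(nmulr_rge0 _ a0).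
  exact: le_trans (generator_le n m _ Df).
have g0 : normD (P n s f) = 0.
  by apply/eqP; rewrite eq_le normD_ge0// andbT (le_trans g_le)// f0 mulr0.
by rewrite g0 f0 !mulr0.
Qed.

Lemma semigroup_rate T n m t f : 0 <= t <= T -> D f ->
  `|P n t f - P m t f| <= rate_constant T * a n m * normD f.
Proof.
move=> tT Df; have /andP[t0 t_le] := tT.
have MT0 : 0 <= M * expR (`|omega| * T) by rewrite mulr_ge0// expR_ge0.
have an0 : 0 <= a n m * normD f by exact: le_trans (generator_le n m _ Df).
pose L := M_D * expR (`|omega_D| * T) * (a n m * normD f).
have L0 : 0 <= L by rewrite mulr_ge0// mulr_ge0// expR_ge0.
have bound k r z : 0 <= r <= t -> `|P k r z| <= M * expR (`|omega| * T) * `|z|.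
  move=> /andP[r0 rt]; apply: le_trans (P_le _ _ _ r0) _.
  by rewrite ler_wpM2r// ler_wpM2l// expR_growth_le// r0 (le_trans rt).
have orbit s : 0 <= s < t -> D (P n s f) by move=> /andP[s0 _]; exact: Dinv.
have H := semigroup_diff_le (f := f) (L := L) (sP n) (sP m) t0 MT0 L0 (bound n) (bound m)
  (fun s st => Ddom n _ (orbit s st)) (fun s st => Ddom m _ (orbit s st)).
apply: (@le_trans _ _ (M * expR (`|omega| * T) * L * T)).
  apply: (@le_trans _ _ (M * expR (`|omega| * T) * L * t)).
    apply: H => s /andP[s0 st]; apply: generator_orbit_diff_le => //.
    by rewrite s0 (le_trans (ltW st)).
  by rewrite ler_wpM2l// mulr_ge0.
by rewrite /rate_constant /L !mulrA [leLHS]mulrAC [X in X * _]mulrAC.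
Qed.

Context (a_cvg0 : a nm.1 nm.2 @[nm --> (\oo, \oo)] --> (0 : R)).

(** The index N depends on f only through the bound c on its D-norm; this
    yields the uniformity on bounded subsets of D. *)
Lemma semigroup_cauchy_dom (T c e : R) : 0 <= T -> 0 < e ->
  exists N : nat, forall n m t f, (N <= n)%N -> (N <= m)%N -> 0 <= t <= T ->
    D f -> normD f <= c -> `|P n t f - P m t f| <= e.
Proof.
move=> T0 e0; have C0 := rate_constant_ge0 _ T0.
pose k := rate_constant T * `|c| + 1.
have k0 : 0 < k by rewrite ltr_wpDl// mulr_ge0.
have /cvgr0Pnorm_le/(_ _ (divr_gt0 e0 k0)) := a_cvg0.
move=> [[A B]/= [[N1 _ NA] [N2 _ NB]] AB].
exists (maxn N1 N2) => n m t f; rewrite !geq_max => /andP[n1 _] /andP[_ m2] tT Df fc.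
have anm : `|a n m| <= e / k by apply: (AB (n, m)); split; [exact: NA|exact: NB].
apply: le_trans (semigroup_rate T n m t f tT Df) _.
rewrite ler_pdivlMr// in anm; apply: le_trans anm.
rewrite mulrAC mulrC; apply: (@le_trans _ _ (`|a n m| * (rate_constant T * normD f))).
  by rewrite ler_wpM2r ?ler_norm// mulr_ge0// normD_ge0.
rewrite ler_wpM2l// /k; apply: (@le_trans _ _ (rate_constant T * `|c|)).
  by rewrite ler_wpM2l// (le_trans fc)// ler_norm.
by rewrite lerDl.
Qed.

(** Replace f by some g in D close to it: the uniform bound on the P n t on
    [0, T] controls both errors at once for all n. *)
Lemma semigroup_cauchy : dense D -> forall f (T e : R), 0 < e ->
  exists N : nat, forall n m t, (N <= n)%N -> (N <= m)%N -> 0 <= t <= T ->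
    `|P n t f - P m t f| <= e.
Proof.
move=> dD f T e e0.
have [T0|T0] := leP 0 T; last first.
  by exists 0%N => n m t _ _ /andP[t0 tT]; have := le_lt_trans (le_trans t0 tT) T0; rewrite ltxx.
pose B := M * expR (`|omega| * T).
have B0 : 0 <= B by rewrite mulr_ge0// expR_ge0.
have B1 : 0 < B + 1 by rewrite ltr_wpDl.
have e3 : 0 < e / 3 by rewrite divr_gt0.
have d0 : 0 < e / 3 / (B + 1) by rewrite divr_gt0.
have [g [fg Dg]] := dD (ball f (e / 3 / (B + 1))) (ex_intro _ f (ballxx f d0))
  (ball_open f _).
rewrite -ball_normE /ball_/= in fg.
have [N PN] := semigroup_cauchy_dom T (normD g) _ T0 e3.
exists N => n m t Nn Nm tT.
have t0 : 0 <= t by case/andP: tT.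
have lP k : linear (P k t) by have [] := scsg_bounded (sP k) t0.
have near_g k : `|P k t f - P k t g| <= e / 3.
  rewrite -(linear_subr (lP k)); apply: le_trans (P_le _ _ _ t0) _.
  apply: (@le_trans _ _ (B * `|f - g|)).
    by rewrite ler_wpM2r// ler_wpM2l// expR_growth_le.
  move/ltW: fg; rewrite ler_pdivlMr//; apply: le_trans.
  by rewrite mulrC ler_wpM2l// lerDl.
have -> : P n t f - P m t f = (P n t f - P n t g) + (P n t g - P m t g) +
    (P m t g - P m t f) by rewrite !subrKA.
have -> : e = e / 3 + e / 3 + e / 3 by lra.
rewrite (le_trans (ler_normD _ _))// lerD//; last by rewrite distrC.
by rewrite (le_trans (ler_normD _ _))// lerD// PN.
Qed.

End GeneratorConvergence.

(** * Convergence of the semigroups *)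
Theorem theorem3p1 (R : realType) (Z : completeNormedModType R)
    (P : nat -> R -> Z -> Z) (M omega : R)
    (D : set Z) (normD : Z -> R) (M_D omega_D : R) (a : nat -> nat -> R) :
  (forall n, strongly_continuous_semigroup (P n)) ->
  1 <= M ->
  (forall n t, 0 <= t -> (opnorm (P n t) <= (M * expR (omega * t))%:E)%E) ->
  submod_closed (mem D) ->
  dense D ->
  D `<=` \bigcap_n generator_dom (P n) ->
  (forall n t f, 0 <= t -> D f -> D (P n t f)) ->
  norm_on D normD ->
  1 <= M_D ->
  (forall n t f, 0 <= t -> D f ->
    normD (P n t f) <= M_D * expR (omega_D * t) * normD f) ->
  a nm.1 nm.2 @[nm --> (\oo, \oo)] --> (0 : R) ->
  (forall n m f, D f ->
    `|generator (P n) f - generator (P m) f| <= a n m * normD f) ->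
  exists Pinf : R -> Z -> Z,
    [/\ strongly_continuous_semigroup Pinf,
        (forall t, 0 <= t -> (opnorm (Pinf t) <= (M * expR (omega * t))%:E)%E),
        (forall (f : Z) (K : set R), compact K -> K `<=` `[0, +oo[ ->
          {uniform K, (fun n t => P n t f) @ \oo --> (fun t => Pinf t f)})
        /\
        (forall (K : set R) (B : set Z), compact K -> K `<=` `[0, +oo[ ->
          B `<=` D -> (exists c, forall f, B f -> normD f <= c) ->
          {uniform K `*` B, (fun n (tf : R * Z) => P n tf.1 tf.2) @ \oo -->
             (fun tf : R * Z => Pinf tf.1 tf.2)}),
        (forall T, 0 < T -> exists C_T : R,
          forall n m t f, 0 <= t <= T -> D f ->
            `|P n t f - P m t f| <= C_T * a n m * normD f) &
        (forall (X : weightedSpace R)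
            (J : {linear Z -> calBrho X}) (Jinv : calBrho X -> Z),
          (forall f, `|J f| = `|f|) -> cancel J Jinv -> cancel Jinv J ->
          (forall n, generalized_feller_semigroup
                       (fun t g => J (P n t (Jinv g)))) ->
          generalized_feller_semigroup (fun t g => J (Pinf t (Jinv g))))].
Proof.
move=> sP M1 P_op _ dD Ddom Dinv normD_norm M_D1 normD_le a_cvg0 gen_le.
have M0 : 0 <= M by rewrite (le_trans ler01).
have M_D0 : 0 <= M_D by rewrite (le_trans ler01).
have P_le n t z : 0 <= t -> `|P n t z| <= M * expR (omega * t) * `|z|.
  by move=> t0; apply: opnorm_bound (P_op n t t0) z; have [] := scsg_bounded (sP n) t0.
have Ddom' n : D `<=` generator_dom (P n) by move=> f /Ddom; exact.
have normD_ge0 f : D f -> 0 <= normD f by exact: (norm_on_ge0 normD_norm).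
have cauchy_dom := semigroup_cauchy_dom sP M0 P_le Ddom' Dinv normD_ge0 M_D0
  normD_le gen_le a_cvg0.
have cauchy_all := semigroup_cauchy sP M0 P_le Ddom' Dinv normD_ge0 M_D0
  normD_le gen_le a_cvg0 dD.
have P_lim := limit_semigroup_cvg cauchy_all.
have Pinf_le := limit_semigroup_le P_le cauchy_all.
have sPinf := limit_semigroup_scsg M0 sP P_le cauchy_all.
exists (limit_semigroup (P := P)); split => //.
- by move=> t t0; apply: opnorm_le (fun z => Pinf_le t z t0); rewrite mulr_ge0// expR_ge0.
- split.
    move=> f K cK K0; have [T T0 KT] := compact_nonneg_bounded cK K0.
    apply: uniform_cvg_dist => e e0.
    have [N PN] := limit_semigroup_uniform cauchy_all f T e e0.
    by exists N => n t Nn /KT /= tT; apply: PN => //; rewrite in_itv in tT.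
  move=> K B cK K0 BD [c Bc]; have [T T0 KT] := compact_nonneg_bounded cK K0.
  apply: uniform_cvg_dist => e e0.
  have [N PN] := cauchy_dom T c e (ltW T0) e0.
  exists N => n [t f] Nn /= [/KT /= tT Bf]; rewrite in_itv/= in tT.
  have t0 : 0 <= t by case/andP: tT.
  apply: (cvg_dist_le N (P_lim t f t0)) => m Nm.
  by apply: PN => //; [exact: BD|exact: Bc].
- move=> T T0; exists (@rate_constant R M omega M_D omega_D T) => n m t f.
  exact: (semigroup_rate sP M0 P_le Ddom' Dinv normD_ge0 M_D0 normD_le gen_le).
- move=> X J Jinv J_norm JK JinvK.
  exact: (generalized_feller_limit J_norm JK JinvK P _ M omega M0 sPinf Pinf_le P_lim).
Qed.
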